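(* Let $n\ge7$ and let $t\ne1$ be a root of $\chi_n$. Then $t$ is either a root of $\psi_n$, or $t$ is a root of $\chi_j$ for some $0\le j\le5$. Specifically, if $t$ is not a root of $\psi_n$, then it is a (primitive) $k$-th root of unity corresponding to one of the following possibilities: (i) $k=2$, $t+1=0$, in which case $2$ divides $n$; (ii) $k=3$, $t^2+t+1=0$, in which case $3$ divides $n$; (iii) $k=5$, $t^4+t^3+t^2+t+1=0$, in which case $n\equiv1 \bmod 5$; (iv) $k=8$, $t^4+1=0$, in which case $n\equiv2\bmod 8$; (v) $k=12$, $t^4-t^2+1=0$, in which case $n\equiv3\bmod 12$; (vi) $k=18$, $t^6-t^3+1=0$, in which case $n\equiv4\bmod 18$; (vii) $k=30$, $t^8+t^7-t^5-t^4-t^3+t+1=0$, in which case $n\equiv5\bmod 30$. Conversely, for each $n\ge7$ and each $k$ satisfying one of the conditions above, there is a corresponding root $t$ of $\chi_n$ which is a (primitive) $k$-th root of unity.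
   Context: For an integer $n\ge0$, $\chi_n(x)=-1+x^2+x^3-x^{1+n}-x^{2+n}+x^{4+n}$. For $n\ge7$, $\chi_n$ has a root $\lambda_n>1$ which is its unique root of modulus greater than one; $\psi_n$ denotes the minimal polynomial of $\lambda_n$ over $\mathbf Q$. *)

(* Defs.v *)
From HB Require Import structures.
From mathcomp Require Import all_boot all_order all_algebra all_field.

Set Implicit Arguments.
Unset Strict Implicit.
Unset Printing Implicit Defensive.

Import Order.TTheory GRing.Theory Num.Theory.
Local Open Scope ring_scope.

Definition chi (n : nat) : {poly int} :=
  - 1 + 'X^2 + 'X^3 - 'X^(1 + n) - 'X^(2 + n) + 'X^(4 + n).

(* Every complex root of the monic integer polynomial [chi n] is algebraic, so
   nothing is lost by taking roots in [algC]. *)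
Definition chiC (n : nat) : {poly algC} := map_poly intr (chi n).

(* The order of [algC] is partial: [1 < lam] entails that [lam] is real. *)
Definition is_lambda (n : nat) (lam : algC) : Prop :=
  [/\ root (chiC n) lam, 1 < lam &
      forall z : algC, root (chiC n) z -> 1 < `|z| -> z = lam].

Definition order_cond (n k : nat) : Prop :=
     (k = 2%N /\ (2 %| n)%N)
  \/ (k = 3%N /\ (3 %| n)%N)
  \/ (k = 5%N /\ (n = 1 %[mod 5])%N)
  \/ (k = 8%N /\ (n = 2 %[mod 8])%N)
  \/ (k = 12%N /\ (n = 3 %[mod 12])%N)
  \/ (k = 18%N /\ (n = 4 %[mod 18])%N)
  \/ (k = 30%N /\ (n = 5 %[mod 30])%N).

Definition possibility (n k : nat) (t : algC) : Prop :=
     [/\ k = 2%N, t + 1 = 0 & (2 %| n)%N]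
  \/ [/\ k = 3%N, t ^+ 2 + t + 1 = 0 & (3 %| n)%N]
  \/ [/\ k = 5%N, t ^+ 4 + t ^+ 3 + t ^+ 2 + t + 1 = 0
       & (n = 1 %[mod 5])%N]
  \/ [/\ k = 8%N, t ^+ 4 + 1 = 0 & (n = 2 %[mod 8])%N]
  \/ [/\ k = 12%N, t ^+ 4 - t ^+ 2 + 1 = 0 & (n = 3 %[mod 12])%N]
  \/ [/\ k = 18%N, t ^+ 6 - t ^+ 3 + 1 = 0 & (n = 4 %[mod 18])%N]
  \/ [/\ k = 30%N,
         t ^+ 8 + t ^+ 7 - t ^+ 5 - t ^+ 4 - t ^+ 3 + t + 1 = 0
       & (n = 5 %[mod 30])%N].

(* Main.v *)
(* A root [t] of [chi n] that is not conjugate to [lam] has all its conjugates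
   in the closed unit disc, so it is a root of unity by Kronecker's theorem.
   Put [y = t^(n+1)]; then [y (t^3 - t - 1) = 1 - t^2 - t^3].  Depending on the
   order of [t] modulo 4, one of [t^2], [- t^2], [- t] is a Galois conjugate
   of [t], and substituting it sends [y] to [y^2], [+- y^2], [+- y].
   Eliminating [y] leaves a polynomial equation in [t] independent of [n], whose
   only factors are [t] and the cyclotomic polynomials of index
   1, 2, 3, 5, 8, 12, 18, 30.  For [t] of order [k] with [chi j] vanishing at
   [t], [t] is a root of [chi n] exactly when [n = j] modulo [k]. *)
Require Import Defs.
From HB Require Import structures.
From mathcomp Require Import all_boot all_order all_algebra all_field.
From mathcomp Require Import ring zify.

Set Implicit Arguments.
Unset Strict Implicit.
Unset Printing Implicit Defensive.

Import Order.TTheory GRing.Theory Num.Theory.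
Local Open Scope ring_scope.

(** * Kronecker's theorem through powers of a companion matrix *)

Lemma eigenvalue_det (F : fieldType) d (A : 'M[F]_d) a :
  eigenvalue A a = (\det (A - a%:M) == 0).
Proof.
apply/eigenvalueP/det0P => [[v vA v0]|[v v0 vA]]; exists v => //.
  by rewrite mulmxBr vA mul_mx_scalar subrr.
by apply/eqP; rewrite -subr_eq0 -mul_mx_scalar -mulmxBr vA.
Qed.

(** Factor X^(m+1) - s into linear terms X - u, evaluate at [A] and take determinants: some factor A
    - u must be singular. *)
Lemma eigenvalue_exp (F : closedFieldType) d (A : 'M[F]_d.+1) m s :
  eigenvalue (A ^+ m.+1) s -> exists2 u, eigenvalue A u & u ^+ m.+1 = s.
Proof.
have [r Er] := closed_field_poly_normal ('X^(m.+1) - s%:P).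
move: Er; rewrite lead_coefDl; last first.
  by rewrite size_polyN size_polyXn (leq_ltn_trans (size_polyC_leq1 _)).
rewrite lead_coefXn scale1r => Er.
rewrite eigenvalue_det => /eqP dA0.
have: \det (horner_mx A ('X^(m.+1) - s%:P)) = 0.
  by rewrite rmorphB rmorphXn /= horner_mx_X horner_mx_C.
rewrite Er rmorph_prod /= (big_morph _ (@det_mulmx F d.+1) (det1 _ _)) => /eqP.
rewrite prodf_seq_eq0 => /hasP[u ur /=].
rewrite rmorphB /= horner_mx_X horner_mx_C -eigenvalue_det => Au.
exists u => //; apply/eqP; rewrite -subr_eq0.
have : root (\prod_(z <- r) ('X - z%:P)) u by rewrite root_prod_XsubC.
by rewrite -Er rootE !hornerE.
Qed.

Lemma eigenvalue_expr (F : fieldType) d (A : 'M[F]_d.+1) m u :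
  eigenvalue A u -> eigenvalue (A ^+ m) (u ^+ m).
Proof.
case/eigenvalueP=> v vA v0; apply/eigenvalueP; exists v => //.
elim: m => [|m IHm]; first by rewrite !expr0 mulmx1 scale1r.
by rewrite exprSr mulmxA IHm -scalemxAl vA scalerA -exprSr.
Qed.

(** Each coefficient of (X - z) q is the difference of a coefficient of q and z times another, so a
    factor with [|z| <= 1] at most doubles the bound. *)
Lemma norm_coef_prod_XsubC (R : numDomainType) (r : seq R) i :
  (forall z, z \in r -> `|z| <= 1) ->
  `|(\prod_(z <- r) ('X - z%:P))`_i| <= (2 ^ size r)%:R.
Proof.
elim: r i => [|z r IHr] i r1.
  by rewrite big_nil coef1; case: (i == 0%N); rewrite ?normr1 ?normr0.
have {}IHr j := IHr j (fun y yr => r1 y (@mem_behead _ (z :: r) y yr)).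
rewrite big_cons mulrBl coefB coefXM coefCM (le_trans (ler_normB _ _)) //.
rewrite expnS mul2n -addnn natrD lerD //.
  by case: i => [|i] /=; rewrite ?normr0 ?ler0n ?IHr.
rewrite normrM (le_trans _ (IHr i)) // ler_piMl ?normr_ge0 //.
by rewrite r1 ?mem_head.
Qed.

Lemma finite_roots_bounded d N : exists S : seq algC,
  forall (p : {poly int}) z, p != 0 -> size p = d.+1 ->
    (forall i, `|p`_i| <= N%:Z) -> root (map_poly intr p) z -> z \in S.
Proof.
pose P (f : {ffun 'I_d.+1 -> 'I_(N.*2).+1}) : {poly algC} :=
  \poly_(i < d.+1) ((f (inord i))%:R - N%:R).
pose rts f := sval (closed_field_poly_normal (P f)).
exists (flatten [seq rts f | f : {ffun 'I_d.+1 -> 'I_(N.*2).+1}]).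
move=> p z p0 sp pN pz.
(* Coefficients lie in [-N, N]; shifting them by [N] codes them as naturals at most 2N, and [P]
   undoes the shift. *)
pose f := [ffun i : 'I_d.+1 => inord `|(p`_i + N%:Z)%R|%N : 'I_(N.*2).+1].
have Pf : P f = map_poly intr p.
  apply/polyP=> i; rewrite coef_poly coef_map /=.
  case: ltnP => [id|di]; last by rewrite nth_default ?sp.
  rewrite ffunE inordK ?inordK //; last by have := pN i; lia.
  have E : (`|(p`_i + N%:Z)%R|%N : int) = p`_i + N%:Z by have := pN i; lia.
  by rewrite -[_%:R]/(_%:Z%:~R) E rmorphD /= addrK.
apply/flattenP; exists (rts f); first by rewrite map_f // mem_enum.
move: pz; rewrite -Pf /rts; case: closed_field_poly_normal => r /= {1}->.
rewrite rootZ ?root_prod_XsubC // Pf lead_coef_map_inj //; last exact: intr_inj.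
by rewrite intr_eq0 lead_coef_eq0.
Qed.

(* The powers of [t] are roots of the characteristic polynomials of the powers
   of one integer matrix, and only finitely many polynomials can occur. *)
Lemma Kronecker (p : {poly int}) (t : algC) :
  p \is monic -> (forall z : algC, root (map_poly intr p) z -> `|z| <= 1) ->
  root (map_poly intr p) t -> t != 0 ->
  exists k, k.-primitive_root t.
Proof.
move=> pm p1 pt t0.
have [n [A pA]] : exists n (A : 'M[int]_n), char_poly A = p.
  by exists (size p).-1, (companionmx p); exact: companionmxK.
(* An empty matrix has characteristic polynomial 1, which has no root. A positive size puts the
   matrices in a ring, where powers make sense. *)
case: n A pA => [|d] A pA.
  have p_1 : p = 1 by rewrite -pA /char_poly det_mx00.
  by move: pt; rewrite p_1 rmorph1 (negPf (root1 _)).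
have [S SP] := finite_roots_bounded d.+1 (2 ^ d.+1).
have eigA z : eigenvalue (map_mx intr A) z = root (map_poly intr p) z.
  by rewrite eigenvalue_root_char -map_char_poly pA.
(* The roots of [q] are (m+1)-th powers of eigenvalues of [A], hence in the closed unit disc, so the
   coefficients of [q] are bounded independently of [m]. *)
have tS m : t ^+ m.+1 \in S.
  pose q := char_poly (A ^+ m.+1).
  have Eq : map_poly intr q = char_poly ((map_mx intr A) ^+ m.+1) :> {poly
    algC}.
    by rewrite map_char_poly rmorphXn.
  have qm : q \is monic by rewrite char_poly_monic.
  apply: (SP q); rewrite ?monic_neq0 ?size_char_poly //; last first.
    rewrite Eq -eigenvalue_root_char; apply: eigenvalue_expr.
    by rewrite eigA.
  move=> i; have [r Er] := closed_field_poly_normal (map_poly intr q : {poly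
    algC}).
  move: Er; rewrite (monicP (monic_map _ qm)) scale1r => Er.
  have sr : size r = d.+1.
    apply: succn_inj; rewrite -(size_prod_XsubC r id) -Er.
    by rewrite size_map_inj_poly ?size_char_poly //; exact: intr_inj.
  rewrite -(ler_int algC) intr_norm -coef_map /= Er -sr.
  apply: norm_coef_prod_XsubC => z.
  rewrite -root_prod_XsubC -Er Eq -eigenvalue_root_char.
  case/eigenvalue_exp=> u; rewrite eigA => /p1 u1 <-.
  by rewrite normrX exprn_ile1.
(* Pigeonhole: more powers of [t] are listed than [S] has entries, so two coincide and their
   quotient gives t^(j-i) = 1. *)
pose T := [seq t ^+ m.+1 | m <- iota 0 (size S).+1].
have /(uniqPn 0) [i [j [ij jT]]] : ~~ uniq T.
  apply: contraTN (ltnSn (size S)) => uT; rewrite -leqNgt.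
  rewrite -[X in (X <= _)%N](size_iota 0) -(size_map (fun m => t ^+ m.+1)).
  by apply: uniq_leq_size => // _ /mapP[m _ ->].
rewrite size_map size_iota in jT.
rewrite !(nth_map 0%N) ?size_iota ?(ltn_trans ij) //.
rewrite !nth_iota ?(ltn_trans ij) // !add0n => /eqP.
rewrite -(subnKC (ltnW ij)) -addSn exprD -{1}[t ^+ i.+1]mulr1.
rewrite (inj_eq (mulfI (expf_neq0 _ t0))) eq_sym => /eqP tk.
have ij0 : (0 < j - i)%N by rewrite subn_gt0.
by have [k kt _] := prim_order_exists ij0 tk; exists k.
Qed.

(** * Conjugacy over the rationals *)

Lemma root_minCpolyW (q : {poly int}) (x y : algC) :
  root (map_poly intr q) x -> root (minCpoly x) y -> root (map_poly intr q) y.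
Proof.
have [p [-> _] pP] := minCpolyP x.
have -> : map_poly intr q = map_poly ratr (map_poly intr q) :> {poly algC}.
  by rewrite -map_poly_comp; apply: eq_map_poly => z /=; rewrite ratr_int.
by rewrite pP => /dvdpP[r ->]; rewrite rmorphM rootM orbC => ->.
Qed.

(** The minimal polynomial q of y divides that of x, say p = r q. By minimality of p the cofactor r,
    of smaller degree, cannot vanish at x, so q does. *)
Lemma root_minCpoly_sym (x y : algC) :
  root (minCpoly x) y -> root (minCpoly y) x.
Proof.
have [p [Ep pm] pP] := minCpolyP x; have [q [Eq _] qP] := minCpolyP y.
rewrite Ep qP => /dvdpP[r Er]; have := root_minCpoly x.
rewrite Ep Er rmorphM rootM /= => /orP[|]; last by rewrite Eq.
have p0 := monic_neq0 pm; rewrite Er mulf_eq0 negb_or in p0.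
have /andP[r0 q0] := p0.
rewrite pP => /(dvdp_leq r0); rewrite Er size_mul //.
have := size_minCpoly y; rewrite Eq size_map_poly.
move: r0; rewrite -size_poly_gt0; move: (size r) (size q) => a b; lia.
Qed.

(** * The equation for t^(n+1) at a root of [chi n] *)

Lemma root_chiC n t :
  root (chiC n) t =
  (t ^+ n.+1 * (t ^+ 3 - t - 1) == 1 - t ^+ 2 - t ^+ 3).
Proof.
rewrite /chiC /chi !rmorphD !rmorphN /= !map_polyXn rmorph1.
rewrite rootE !hornerE -[RHS]subr_eq0; congr (_ == 0).
by rewrite !exprD exprS; ring.
Qed.

Lemma chi_monic n : chi n \is monic.
Proof.
have ltD (p q : {poly int}) m :
    (size p < m)%N -> (size q < m)%N -> (size (p + q)%R < m)%N.
  by move=> ? ?; rewrite (leq_ltn_trans (size_polyD _ _)) // gtn_max;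
    apply/andP.
rewrite /chi monicE lead_coefDr ?lead_coefXn //.
by rewrite !(ltD, size_polyN, size_polyXn, size_poly1) //; lia.
Qed.

Lemma root_chiC_neq0 n t : root (chiC n) t -> t != 0.
Proof.
rewrite root_chiC; apply: contraTneq => ->.
by rewrite exprS !mul0r !expr0n /= !subr0 eq_sym oner_neq0.
Qed.

Lemma root_chiC_den n t : root (chiC n) t -> t ^+ 3 - t - 1 != 0.
Proof.
rewrite root_chiC; apply: contraTneq => D0; rewrite D0 mulr0 eq_sym.
apply: contra_neq (oner_neq0 algC) => N0.
(* A Bezout identity: t^3 - t - 1 and 1 - t^2 - t^3 have no common zero. *)
have -> : 1 = (1 - t) * (1 - t ^+ 2 - t ^+ 3) - t * (t ^+ 3 - t - 1) by ring.
by rewrite N0 D0 !mulr0 subrr.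
Qed.

(** As t^3 - t - 1 is nonzero, the root equation determines t^(n+1) from [t] alone; it thus amounts
    to t^(n+1) = t^(j+1). *)
Lemma root_chiC_mod n j k t : k.-primitive_root t -> root (chiC j) t ->
  root (chiC n) t = (n == j %[mod k]).
Proof.
move=> kt jt; have D0 := root_chiC_den jt.
move: jt; rewrite !root_chiC => /eqP<-.
by rewrite (inj_eq (mulIf D0)) (eq_prim_root_expr kt)
  -[n.+1]addn1 -[j.+1]addn1 eqn_modDr.
Qed.

(** * Substituting Galois conjugates of a root of unity *)

Lemma root_chiC_expr n a k t : k.-primitive_root t -> coprime a k ->
  root (chiC n) t -> root (chiC n) (t ^+ a).
Proof.
move=> kt ak nt; apply: (root_minCpolyW nt).
by rewrite (minCpoly_cyclotomic kt) root_cyclotomic ?prim_root_exp_coprime.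
Qed.

Lemma prim_root_half h (t : algC) : (h.*2).-primitive_root t -> t ^+ h = -1.
Proof.
move=> ht; have h0 : (0 < h)%N by have := prim_order_gt0 ht; lia.
have /eqP := prim_expr_order ht; rewrite -muln2 exprM sqrf_eq1.
case/orP=> /eqP // /eqP; rewrite -(prim_order_dvd ht) => /(dvdn_leq h0).
by lia.
Qed.

Lemma root_chiC_sqr n k t : k.-primitive_root t -> odd k ->
  root (chiC n) t -> root (chiC n) (t ^+ 2).
Proof. by move=> kt ok; apply: root_chiC_expr kt _; rewrite coprime2n. Qed.

(** Since t^h = -1, the element -t^2 is t^(h+2), and h + 2 is coprime to 2h for odd [h]. *)
Lemma root_chiC_oppr_sqr n h t : (h.*2).-primitive_root t -> odd h ->
  root (chiC n) t -> root (chiC n) (- t ^+ 2).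
Proof.
move=> ht oh; rewrite -mulN1r -(prim_root_half ht) -exprD.
apply: root_chiC_expr ht _; rewrite -muln2 coprimeMr coprimen2 oddD oh andbT.
by rewrite /coprime gcdnC gcdnDl -/(coprime h 2) coprimen2.
Qed.

(** Here -t = t^(h+1), and h + 1 is coprime to 2h for even [h]. *)
Lemma root_chiC_oppr n h t : (h.*2).-primitive_root t -> ~~ odd h ->
  root (chiC n) t -> root (chiC n) (- t).
Proof.
move=> ht eh; rewrite -mulN1r -(prim_root_half ht) -exprSr.
apply: root_chiC_expr ht _; rewrite -muln2 coprimeMr coprimeSn coprimen2 /=.
by rewrite eh.
Qed.

(** * Elimination of t^(n+1) *)

Lemma sign_cases (R : pzRingType) m :
  (-1) ^+ m = 1 :> R \/ (-1) ^+ m = -1 :> R.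
Proof. by rewrite -signr_odd; case: odd; [right|left]. Qed.

(** Meant for y = t^(n+1): [N], [D] are the values at [t] of 1 - X^2 - X^3 and X^3 - X - 1, [N'],
    [D'] those at the conjugate, and [e] is the sign produced by the substitution. *)
Lemma elim_sqr (R : comPzRingType) (y e N D N' D' : R) :
  y * D = N -> e * y ^+ 2 * D' = N' -> e * N ^+ 2 * D' = N' * D ^+ 2.
Proof. by move=> <- <-; ring. Qed.

Lemma elim_lin (R : comPzRingType) (y e N D N' D' : R) :
  y * D = N -> e * y * D' = N' -> e * N * D' = N' * D.
Proof. by move=> <- <-; ring. Qed.

Lemma cyclotomic_odd n k t : k.-primitive_root t -> odd k -> t != 1 ->
  root (chiC n) t ->
  [\/ t + 1 = 0, t ^+ 2 + t + 1 = 0 | t ^+ 4 + t ^+ 3 + t ^+ 2 + t + 1 = 0].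
Proof.
move=> kt ok t1 nt; have := root_chiC_sqr kt ok nt.
move: nt; rewrite !root_chiC (exprAC t 2 n.+1) => /eqP yt /eqP.
rewrite -[X in X * _ = _]mul1r => /(elim_sqr yt)/eqP; rewrite -subr_eq0.
set p := (X in X == 0).
have -> : p = 2 * (t - 1) ^+ 3 * (t + 1) * (t ^+ 2 + t + 1) ^+ 2 *
    (t ^+ 4 + t ^+ 3 + t ^+ 2 + t + 1) by rewrite /p; ring.
rewrite !mulf_eq0 pnatr_eq0 subr_eq0 (negPf t1) !orbb /= -orbA.
by case/or3P=> /eqP; [constructor 1|constructor 2|constructor 3].
Qed.

Lemma cyclotomic_double_odd n h t : (h.*2).-primitive_root t -> odd h ->
  t != 1 -> root (chiC n) t ->
  [\/ t + 1 = 0, t ^+ 4 - t ^+ 2 + 1 = 0, t ^+ 6 - t ^+ 3 + 1 = 0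
    | t ^+ 8 + t ^+ 7 - t ^+ 5 - t ^+ 4 - t ^+ 3 + t + 1 = 0].
Proof.
move=> ht oh t1 nt; have t0 := root_chiC_neq0 nt.
have := root_chiC_oppr_sqr ht oh nt; move: nt; rewrite !root_chiC => /eqP yt.
rewrite (exprNn _ n.+1) (exprAC t 2 n.+1) => /eqP/(elim_sqr yt)/eqP.
rewrite -subr_eq0; set p := (X in X == 0).
(* The sign is (-1)^(n+1): odd [n] leads to the indices 12 and 30, even [n] to 2 and 18. *)
have [En|En] := sign_cases algC n.+1.
  have -> : p = - 2 * (t ^+ 4 - t ^+ 2 + 1) *
      (t ^+ 8 + t ^+ 7 - t ^+ 5 - t ^+ 4 - t ^+ 3 + t + 1).
    by rewrite /p En; ring.
  rewrite !mulf_eq0 oppr_eq0 pnatr_eq0 /=.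
  by case/orP=> /eqP; [constructor 2|constructor 4].
have -> : p = 2 * t * (t - 1) * (t + 1) ^+ 3 * (t ^+ 6 - t ^+ 3 + 1).
  by rewrite /p En; ring.
rewrite !mulf_eq0 pnatr_eq0 subr_eq0 (negPf t1) (negPf t0) !orbb /=.
by case/orP=> /eqP; [constructor 1|constructor 3].
Qed.

Lemma cyclotomic_double_even n h t : (h.*2).-primitive_root t -> ~~ odd h ->
  t != 1 -> root (chiC n) t ->
  [\/ t + 1 = 0, t ^+ 4 + 1 = 0 | t ^+ 4 - t ^+ 2 + 1 = 0].
Proof.
move=> ht eh t1 nt; have t0 := root_chiC_neq0 nt.
have := root_chiC_oppr ht eh nt; move: nt; rewrite !root_chiC => /eqP yt.
rewrite (exprNn _ n.+1) => /eqP/(elim_lin yt)/eqP.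
rewrite -subr_eq0; set p := (X in X == 0).
(* Odd [n] leads to index 12, even [n] to 2 and 8. *)
have [En|En] := sign_cases algC n.+1.
  have -> : p = 2 * t * (t ^+ 4 - t ^+ 2 + 1) by rewrite /p En; ring.
  rewrite !mulf_eq0 pnatr_eq0 (negPf t0) /= => /eqP.
  by constructor 3.
have -> : p = - 2 * (t - 1) * (t + 1) * (t ^+ 4 + 1).
  by rewrite /p En; ring.
rewrite !mulf_eq0 oppr_eq0 pnatr_eq0 subr_eq0 (negPf t1) /=.
by case/orP=> /eqP; [constructor 1|constructor 2].
Qed.

(** * The cyclotomic polynomials of index 2, 3, 5, 8, 12, 18, 30 *)

Lemma prim_root_primes k (t : algC) : (0 < k)%N -> t ^+ k = 1 ->
  all (fun p => t ^+ (k %/ p) != 1) (primes k) -> k.-primitive_root t.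
Proof.
move=> k0 tk /allP kP; have [m mt mk] := prim_order_exists k0 tk.
have [q0 Eq] := dvdnP mk; have [q_1|q1] := leqP q0 1.
  suff -> : k = m by [].
  by move: q_1 k0; rewrite Eq; case: q0 {Eq} => [|[]] //=; rewrite mul1n.
(* If the order [m] is a proper divisor of [k], it divides k/p for a prime p dividing k/m, against
   the hypothesis. *)
have pk : pdiv q0 \in primes k.
  by rewrite mem_primes pdiv_prime //= k0 Eq dvdn_mulr // pdiv_dvd.
have /negP[] := kP _ pk; rewrite -(prim_order_dvd mt) Eq.
by rewrite mulnC -muln_divA ?pdiv_dvd // dvdn_mulr.
Qed.

Lemma bezout_expr_neq1 c m (u v P t : algC) :
  c.+1%:R = u * P + v * (t ^+ m - 1) -> P = 0 -> t ^+ m != 1.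
Proof.
move=> E P0; apply/eqP=> tm; move/eqP: E.
by rewrite P0 tm subrr !mulr0 addr0 pnatr_eq0.
Qed.

(** Common scheme for the seven indices: P divides [chi j] and X^k - 1, and a Bezout identity with
    X^(k/p) - 1 for each prime p dividing k excludes smaller orders. The constant [c.+1] is p: P
    divides (X^k - 1)/(X^(k/p) - 1), which is congruent to p modulo X^(k/p) - 1. *)
Lemma Phi2_root (t : algC) :
  t + 1 = 0 ->
  2.-primitive_root t /\ root (chiC 0) t.
Proof.
move=> P0; split; last first.
  rewrite root_chiC -subr_eq0.
  rewrite (_ : _ - _ = (t ^+ 3 - 1) * (t + 1)); last by ring.
  by rewrite P0 mulr0.
apply: prim_root_primes => //.
  apply/eqP; rewrite -subr_eq0.
  rewrite (_ : _ - 1 = (t - 1) * (t + 1)); last by ring.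
  by rewrite P0 mulr0.
rewrite (_ : primes 2 = [:: 2]) //= ?andbT.
apply: (@bezout_expr_neq1 1 1 (1)
    (- 1) _ t _ P0); ring.
Qed.

Lemma Phi3_root (t : algC) :
  t ^+ 2 + t + 1 = 0 ->
  3.-primitive_root t /\ root (chiC 0) t.
Proof.
move=> P0; split; last first.
  rewrite root_chiC -subr_eq0.
  rewrite (_ : _ - _ = (t ^+ 2 - 1) * (t ^+ 2 + t + 1)); last by ring.
  by rewrite P0 mulr0.
apply: prim_root_primes => //.
  apply/eqP; rewrite -subr_eq0.
  rewrite (_ : _ - 1 = (t - 1) * (t ^+ 2 + t + 1)); last by ring.
  by rewrite P0 mulr0.
rewrite (_ : primes 3 = [:: 3]) //= ?andbT.
apply: (@bezout_expr_neq1 2 1 (1)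
    (- t - 2) _ t _ P0); ring.
Qed.

Lemma Phi5_root (t : algC) :
  t ^+ 4 + t ^+ 3 + t ^+ 2 + t + 1 = 0 ->
  5.-primitive_root t /\ root (chiC 1) t.
Proof.
move=> P0; split; last first.
  rewrite root_chiC -subr_eq0.
  rewrite (_ : _ - _ = (t - 1) * (t ^+ 4 + t ^+ 3 + t ^+ 2 + t + 1)); last by
    ring.
  by rewrite P0 mulr0.
apply: prim_root_primes => //.
  apply/eqP; rewrite -subr_eq0.
  rewrite (_ : _ - 1 = (t - 1) * (t ^+ 4 + t ^+ 3 + t ^+ 2 + t + 1)); last by
    ring.
  by rewrite P0 mulr0.
rewrite (_ : primes 5 = [:: 5]) //= ?andbT.
apply: (@bezout_expr_neq1 4 1 (1)
    (- t ^+ 3 - 2 * t ^+ 2 - 3 * t - 4) _ t _ P0); ring.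
Qed.

Lemma Phi8_root (t : algC) :
  t ^+ 4 + 1 = 0 ->
  8.-primitive_root t /\ root (chiC 2) t.
Proof.
move=> P0; split; last first.
  rewrite root_chiC -subr_eq0.
  rewrite (_ : _ - _ = (t ^+ 2 - 1) * (t ^+ 4 + 1)); last by ring.
  by rewrite P0 mulr0.
apply: prim_root_primes => //.
  apply/eqP; rewrite -subr_eq0.
  rewrite (_ : _ - 1 = (t ^+ 4 - 1) * (t ^+ 4 + 1)); last by ring.
  by rewrite P0 mulr0.
rewrite (_ : primes 8 = [:: 2]) //= ?andbT.
apply: (@bezout_expr_neq1 1 4 (1)
    (- 1) _ t _ P0); ring.
Qed.

Lemma Phi12_root (t : algC) :
  t ^+ 4 - t ^+ 2 + 1 = 0 ->
  12.-primitive_root t /\ root (chiC 3) t.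
Proof.
move=> P0; split; last first.
  rewrite root_chiC -subr_eq0.
  rewrite (_ : _ - _ = (t ^+ 3 - 1) * (t ^+ 4 - t ^+ 2 + 1)); last by ring.
  by rewrite P0 mulr0.
apply: prim_root_primes => //.
  apply/eqP; rewrite -subr_eq0.
  rewrite (_ : _ - 1 = (t ^+ 8 + t ^+ 6 - t ^+ 2 - 1) * (t ^+ 4 - t ^+ 2 +
    1)); last by ring.
  by rewrite P0 mulr0.
rewrite (_ : primes 12 = [:: 2; 3]) //= ?andbT.
apply/andP; split.
- apply: (@bezout_expr_neq1 1 6 (t ^+ 2 + 1)
    (- 1) _ t _ P0); ring.
- apply: (@bezout_expr_neq1 2 4 (t ^+ 2 + 2)
    (- t ^+ 2 - 1) _ t _ P0); ring.
Qed.

Lemma Phi18_root (t : algC) :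
  t ^+ 6 - t ^+ 3 + 1 = 0 ->
  18.-primitive_root t /\ root (chiC 4) t.
Proof.
move=> P0; split; last first.
  rewrite root_chiC -subr_eq0.
  rewrite (_ : _ - _ = (t ^+ 2 - 1) * (t ^+ 6 - t ^+ 3 + 1)); last by ring.
  by rewrite P0 mulr0.
apply: prim_root_primes => //.
  apply/eqP; rewrite -subr_eq0.
  rewrite (_ : _ - 1 = (t ^+ 12 + t ^+ 9 - t ^+ 3 - 1) * (t ^+ 6 - t ^+ 3 +
    1)); last by ring.
  by rewrite P0 mulr0.
rewrite (_ : primes 18 = [:: 2; 3]) //= ?andbT.
apply/andP; split.
- apply: (@bezout_expr_neq1 1 9 (t ^+ 3 + 1)
    (- 1) _ t _ P0); ring.
- apply: (@bezout_expr_neq1 2 6 (t ^+ 3 + 2)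
    (- t ^+ 3 - 1) _ t _ P0); ring.
Qed.

Lemma Phi30_root (t : algC) :
  t ^+ 8 + t ^+ 7 - t ^+ 5 - t ^+ 4 - t ^+ 3 + t + 1 = 0 ->
  30.-primitive_root t /\ root (chiC 5) t.
Proof.
move=> P0; split; last first.
  rewrite root_chiC -subr_eq0.
  rewrite (_ : _ - _ = (t - 1) * (t ^+ 8 + t ^+ 7 - t ^+ 5 - t ^+ 4 - t ^+ 3 +
    t + 1)); last by ring.
  by rewrite P0 mulr0.
apply: prim_root_primes => //.
  apply/eqP; rewrite -subr_eq0.
  rewrite (_ : _ - 1 = (t ^+ 22 - t ^+ 21 + t ^+ 20 + t ^+ 17 - t ^+ 16 + t ^+
    15 - t ^+ 7 + t ^+ 6 - t ^+ 5 - t ^+ 2 + t - 1) * (t ^+ 8 + t ^+ 7 - t ^+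
    5 - t ^+ 4 - t ^+ 3 + t + 1)); last by ring.
  by rewrite P0 mulr0.
rewrite (_ : primes 30 = [:: 2; 3; 5]) //= ?andbT.
apply/and3P; split.
- apply: (@bezout_expr_neq1 1 15 (t ^+ 7 - t ^+ 6 + t ^+ 5 + t ^+ 2 - t + 1)
    (- 1) _ t _ P0); ring.
- apply: (@bezout_expr_neq1 2 10 (t ^+ 7 - t ^+ 6 + t ^+ 5 + 2 * t ^+ 2 - 2 *
  t + 2)
    (- t ^+ 5 - 1) _ t _ P0); ring.
- apply: (@bezout_expr_neq1 4 6 (2 * t ^+ 5 + t ^+ 4 - t ^+ 3 + 3 * t ^+ 2 - t
  + 1)
    (- 2 * t ^+ 7 - 3 * t ^+ 6 + t ^+ 3 + 2 * t ^+ 2 - 4) _ t _ P0); ring.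
Qed.

(** * Matching roots of unity with congruences on n *)

Lemma possibility_prim n k t : possibility n k t ->
  k.-primitive_root t /\ exists2 j, (j <= 5)%N & root (chiC j) t.
Proof.
case=> [|[|[|[|[|[|]]]]]] [->].
- by move=> /Phi2_root[kt jt] _; split=> //; exists 0%N.
- by move=> /Phi3_root[kt jt] _; split=> //; exists 0%N.
- by move=> /Phi5_root[kt jt] _; split=> //; exists 1%N.
- by move=> /Phi8_root[kt jt] _; split=> //; exists 2%N.
- by move=> /Phi12_root[kt jt] _; split=> //; exists 3%N.
- by move=> /Phi18_root[kt jt] _; split=> //; exists 4%N.
- by move=> /Phi30_root[kt jt] _; split=> //; exists 5%N.
Qed.

Lemma prim_root_possibility n k t : k.-primitive_root t -> t != 1 ->
  root (chiC n) t -> exists m, possibility n m t.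
Proof.
move=> kt t1 nt.
(* Each possible factor fixes the order of [t] and some [j] with [chi j] vanishing at [t];
   [root_chiC_mod] then yields the congruence on [n]. *)
have p2 : t + 1 = 0 -> exists m, possibility n m t.
  move=> P0; have [mt jt] := Phi2_root P0; exists 2; left; split=> //.
  by move: nt; rewrite (root_chiC_mod _ mt jt) mod0n.
have p3 : t ^+ 2 + t + 1 = 0 -> exists m, possibility n m t.
  move=> P0; have [mt jt] := Phi3_root P0; exists 3; right; left; split=> //.
  by move: nt; rewrite (root_chiC_mod _ mt jt) mod0n.
have p5 : t ^+ 4 + t ^+ 3 + t ^+ 2 + t + 1 = 0 -> exists m, possibility n m t.
  move=> P0; have [mt jt] := Phi5_root P0; exists 5.
  do 2!right; left; split=> //; apply/eqP.
  by rewrite -(root_chiC_mod _ mt jt).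
have p8 : t ^+ 4 + 1 = 0 -> exists m, possibility n m t.
  move=> P0; have [mt jt] := Phi8_root P0; exists 8.
  do 3!right; left; split=> //; apply/eqP.
  by rewrite -(root_chiC_mod _ mt jt).
have p12 : t ^+ 4 - t ^+ 2 + 1 = 0 -> exists m, possibility n m t.
  move=> P0; have [mt jt] := Phi12_root P0; exists 12.
  do 4!right; left; split=> //; apply/eqP.
  by rewrite -(root_chiC_mod _ mt jt).
have p18 : t ^+ 6 - t ^+ 3 + 1 = 0 -> exists m, possibility n m t.
  move=> P0; have [mt jt] := Phi18_root P0; exists 18.
  do 5!right; left; split=> //; apply/eqP.
  by rewrite -(root_chiC_mod _ mt jt).
have p30 : t ^+ 8 + t ^+ 7 - t ^+ 5 - t ^+ 4 - t ^+ 3 + t + 1 = 0 ->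
    exists m, possibility n m t.
  move=> P0; have [mt jt] := Phi30_root P0; exists 30.
  do 6!right; split=> //; apply/eqP.
  by rewrite -(root_chiC_mod _ mt jt).
(* The order modulo 4 decides which conjugate is available: t^2 for odd [k], -t^2 for [k] twice an
   odd number, -t for [k] divisible by 4. *)
have [ok|ek] := boolP (odd k); first by case: (cyclotomic_odd kt ok t1 nt).
move: kt; rewrite -(even_halfK ek) => kt.
have [oh|eh] := boolP (odd k./2).
  by case: (cyclotomic_double_odd kt oh t1 nt).
by case: (cyclotomic_double_even kt eh t1 nt).
Qed.

(** Coefficients are listed from the constant term up; the final 1 makes the polynomial monic of
    positive degree. [horner_rec] reduces to an explicit expression in [t] that [ring] can compare
    with the cyclotomic formulas. *)
Lemma monic_horner_root (F : closedFieldType) (a : F) s :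
  exists t, horner_rec (a :: rcons s 1) t = 0.
Proof.
have szP : Poly (a :: rcons s 1) = a :: rcons s 1 :> seq F.
  by apply: (@PolyK _ a); rewrite /= last_rcons oner_neq0.
have /closed_rootP[t] : size (Poly (a :: rcons s 1)) != 1.
  by rewrite szP /= size_rcons.
by rewrite rootE horner_Poly => /eqP Pt; exists t.
Qed.

Lemma order_cond_possibility n k : order_cond n k ->
  exists t, root (chiC n) t /\ possibility n k t.
Proof.
case=> [|[|[|[|[|[|]]]]]] [-> nk].
- have [t /= Et] := monic_horner_root (1 : algC) [::].
  have P0 : t + 1 = 0.
    by rewrite -Et; ring.
  have [kt jt] := Phi2_root P0; exists t; split; last by left.
  by rewrite (root_chiC_mod _ kt jt) mod0n.
- have [t /= Et] := monic_horner_root (1 : algC) [:: 1].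
  have P0 : t ^+ 2 + t + 1 = 0.
    by rewrite -Et; ring.
  have [kt jt] := Phi3_root P0; exists t; split; last by do 1!right; left.
  by rewrite (root_chiC_mod _ kt jt) mod0n.
- have [t /= Et] := monic_horner_root (1 : algC) [:: 1; 1; 1].
  have P0 : t ^+ 4 + t ^+ 3 + t ^+ 2 + t + 1 = 0.
    by rewrite -Et; ring.
  have [kt jt] := Phi5_root P0; exists t; split; last by do 2!right; left.
  by rewrite (root_chiC_mod _ kt jt) nk.
- have [t /= Et] := monic_horner_root (1 : algC) [:: 0; 0; 0].
  have P0 : t ^+ 4 + 1 = 0.
    by rewrite -Et; ring.
  have [kt jt] := Phi8_root P0; exists t; split; last by do 3!right; left.
  by rewrite (root_chiC_mod _ kt jt) nk.
- have [t /= Et] := monic_horner_root (1 : algC) [:: 0; -1; 0].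
  have P0 : t ^+ 4 - t ^+ 2 + 1 = 0.
    by rewrite -Et; ring.
  have [kt jt] := Phi12_root P0; exists t; split; last by do 4!right; left.
  by rewrite (root_chiC_mod _ kt jt) nk.
- have [t /= Et] := monic_horner_root (1 : algC) [:: 0; 0; -1; 0; 0].
  have P0 : t ^+ 6 - t ^+ 3 + 1 = 0.
    by rewrite -Et; ring.
  have [kt jt] := Phi18_root P0; exists t; split; last by do 5!right; left.
  by rewrite (root_chiC_mod _ kt jt) nk.
- have [t /= Et] := monic_horner_root (1 : algC) [:: 1; 0; -1; -1; -1; 0; 1].
  have P0 : t ^+ 8 + t ^+ 7 - t ^+ 5 - t ^+ 4 - t ^+ 3 + t + 1 = 0.
    by rewrite -Et; ring.
  have [kt jt] := Phi30_root P0; exists t; split; last by do 6!right.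
  by rewrite (root_chiC_mod _ kt jt) nk.
Qed.

(** Kronecker's theorem is applied to the minimal polynomial of [t], not to [chi n], which has the
    root [lam] outside the disc. A conjugate of [t] of modulus above 1 would be [lam], making [t]
    conjugate to [lam]. *)
Lemma nonconjugate_prim_root n lam t : is_lambda n lam ->
  root (chiC n) t -> ~~ root (minCpoly lam) t -> exists k, k.-primitive_root t.
Proof.
move=> [nlam lam1 lamP] nt lamt.
have tA : t \in Aint.
  apply: (root_monic_Aint nt); first exact: monic_map (chi_monic n).
  by apply/polyOverP=> i; rewrite coef_map /= intr_int.
(* As [t] is an algebraic integer, its minimal polynomial has integer coefficients. *)
have [p Ep] := floorpP tA; rewrite /= in Ep.
apply: (@Kronecker p t); rewrite -?Ep ?root_minCpoly ?(root_chiC_neq0 nt) //.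
  have := minCpoly_monic t; rewrite Ep !monicE lead_coef_map_inj //; last first.
    exact: intr_inj.
  by rewrite -[X in _ == X -> _]/(1%:~R) eqr_int.
move=> z tz; have nz := root_minCpolyW nt tz.
rewrite real_leNgt ?normr_real ?real1 //; apply: contra lamt => z1.
by apply: root_minCpoly_sym; rewrite -(lamP z nz z1).
Qed.

Theorem theorem3p3 (n : nat) (hn : (7 <= n)%N) :
  (forall lam t : algC,
     is_lambda n lam -> root (chiC n) t -> t <> 1 ->
     (root (minCpoly lam) t \/
        exists j : nat, (j <= 5)%N /\ root (chiC j) t) /\
     (~ root (minCpoly lam) t ->
        exists k : nat, k.-primitive_root t /\ possibility n k t)) /\
  (forall k : nat, order_cond n k ->
     exists t : algC,
       [/\ root (chiC n) t, k.-primitive_root t & possibility n k t]).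

Proof.
split=> [lam t lamP nt /eqP t1|k nk]; last first.
  have [t [nt kt]] := order_cond_possibility nk.
  by exists t; split=> //; have [] := possibility_prim kt.
have [lamt|lamt] := boolP (root (minCpoly lam) t); first by split; [left|].
have [k kt] := nonconjugate_prim_root lamP nt lamt.
have [m mt] := prim_root_possibility kt t1 nt.
have [mprim [j j5 jt]] := possibility_prim mt.
by split; [right; exists j|exists m].
Qed.
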